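(* Let $m\ge 2$, let $p_1,\dots,p_m$ be distinct primes, and let $G_1=P_1\times P_2\times\cdots\times P_m$, where for each $i\in\{1,\dots,m\}$, $P_i$ is a finite $p_i$-group which is neither cyclic nor generalized quaternion. Let $s_i$ be the number of distinct subgroups of order $p_i$ of $G_1$. Then $$\gamma(\mathcal{G}_E^{**}(G_1))=\min_{1\le i\le m}s_i.$$ Moreover, if $G=G_1\times\mathbb{Z}_n$ with $n$ a positive integer and $\gcd(n,|G_1|)=1$, then also $$\gamma(\mathcal{G}_E^{**}(G))=\min_{1\le i\le m}s_i.$$
   Context: For a group $G$, the enhanced power graph $\mathcal{G}_E(G)$ is the simple graph with vertex set $G$ in which two distinct elements $x,y$ are adjacent if and only if there is $w\in G$ with $x,y\in\langle w\rangle$. A dominating vertex of a graph is a vertex adjacent to every other vertex. The proper enhanced power graph $\mathcal{G}_E^{**}(G)$ is the induced subgraph of $\mathcal{G}_E(G)$ obtained by deleting all dominating vertices of $\mathcal{G}_E(G)$. A set $S$ of vertices of a graph $\Gamma$ with vertex set $V$ is dominating if every vertex of $V\setminus S$ is adjacent to some vertex of $S$; the domination number $\gamma(\Gamma)$ is the minimum cardinality of a dominating set. A $p$-group is a group of order $p^r$ with $r\ge 1$. $\mathbb{Z}_n$ is the cyclic group of order $n$. *)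

(* Defs.v *)
From mathcomp Require Import all_boot all_fingroup all_solvable.

Set Implicit Arguments.
Unset Strict Implicit.
Unset Printing Implicit Defensive.

Local Open Scope group_scope.

(* A finite simple graph is given by its vertex set V : {set T} together with
   an adjacency relation e : rel T, of which only the restriction to V matters;
   an induced subgraph keeps e and shrinks V. *)
Section Graphs.

Variables (T : finType) (V : {set T}) (e : rel T).

Definition dominating_vertex (x : T) : bool :=
  (x \in V) && [forall y in V, (y != x) ==> e x y].

Definition dominating_set (S : {set T}) : bool :=
  (S \subset V) && [forall x in V :\: S, [exists y in S, e x y]].

(* The default witness V of the minimum is itself a dominating set. *)
Definition domination_number : nat :=
  #|[arg min_(S < V | dominating_set S) #|S|]|.

End Graphs.

Section EnhancedPowerGraph.

Variables (gT : finGroupType) (G : {group gT}).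

Definition epg_adj : rel gT :=
  fun x y => (x != y) && [exists w in G, (x \in <[w]>) && (y \in <[w]>)].

Definition proper_epg_vertices : {set gT} :=
  [set x in G | ~~ dominating_vertex G epg_adj x].

Definition proper_epg_domination_number : nat :=
  domination_number proper_epg_vertices epg_adj.

Definition num_subgroups_of_order (q : nat) : nat :=
  #|[set H : {group gT} | (H \subset G) && (#|H| == q)]|.

Definition generalized_quaternion : Prop :=
  exists2 n, 2 < n & G \isog 'Q_(2 ^ n).

End EnhancedPowerGraph.

(* Main.v *)
Require Import Defs.
From mathcomp Require Import all_boot all_fingroup zmodp all_solvable.

(** Let [pi = {p_1, ..., p_m}].  The groups of both parts are nilpotent, and
    [C = 'O_pi^'(G)] is cyclic: it is trivial for [G1], and it is the factor
    Z_n for [G1 x Z_n].  Everything rests on the fact that a cyclic group has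
    at most one subgroup of each order, while in a nilpotent group two elements
    of coprime orders lie in the cyclic group generated by their product.

    A p-group that is neither cyclic nor generalized quaternion has at least two
    subgroups of order p ([pgroup_prime_subgroups_gt1]).  Hence an element
    outside [C], whose powers include some [z] of order some [p_i], is not
    joined to a generator of another subgroup of order [p_i]; and an element of
    [C] is joined to everything since [C] is cyclic.  So the dominating vertices
    are exactly the elements of [C] ([dominating_vertex_pcore]).

    Upper bound ([dominating_generators]): for any [i], one generator of each
    subgroup of order [p_i] gives a dominating set, because an element [x] of
    order prime to [p_i] is joined to every element of order [p_i], and
    otherwise [<[x]>] contains a subgroup of order [p_i].

    Lower bound ([dominating_set_ge]): a set [D] with fewer than [s_i] elements
    for all [i] misses, for each [i], some subgroup [H_i] of order [p_i], as each
    [<[x]>] contains at most one of them.  Take [y] with all the [H_i] inside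
    [<[y]>].  If [y] were joined to some [x] of [D], then some [p_i] would divide
    the order of [x], and the subgroups of order [p_i] of [<[x]>] and [<[y]>]
    would coincide, making [H_i] a subgroup of [<[x]>]. *)

Set Implicit Arguments.
Unset Strict Implicit.
Unset Printing Implicit Defensive.

Local Open Scope group_scope.

(** * Minima over a finite family *)

Lemma bigminn_le (I : finType) (F : I -> nat) (x : nat) (i : I) :
  \big[minn/x]_j F j <= F i.
Proof.
have: i \in index_enum I by rewrite mem_index_enum.
elim: (index_enum I) => //= j r IHr; rewrite big_cons in_cons.
case/predU1P=> [<- | /IHr]; first exact: geq_minl.
exact: leq_trans (geq_minr _ _).
Qed.

Lemma bigminn_ge (I : finType) (F : I -> nat) (i0 : I) (k : nat) :
  (forall i, k <= F i) -> k <= \big[minn/F i0]_j F j.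
Proof.
by move=> lekF; elim/big_ind: _ => // a b le_a le_b; rewrite leq_min le_a.
Qed.

(** * Subgroups of prime order *)

Lemma cycle_subgroup_inj (gT : finGroupType) (w : gT) (A B : {group gT}) :
  A \subset <[w]> -> B \subset <[w]> -> #|A| = #|B| -> A = B.
Proof.
move=> sAw sBw eqAB; apply/val_inj/eqP => /=.
by rewrite (eq_subG_cyclic (cycle_cyclic w) sAw sBw) eqAB.
Qed.

Lemma cycle_prime_subgroup (gT : finGroupType) (x : gT) (q : nat) :
  prime q -> q %| #[x] -> exists2 H : {group gT}, H \subset <[x]> & #|H| = q.
Proof.
move=> q_pr /(Cauchy q_pr)[z xz oz].
by exists <[z]>%G; rewrite ?cycle_subG.
Qed.

Lemma nilpotent_commute (gT : finGroupType) (G : {group gT}) (a b : gT) :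
  nilpotent G -> a \in G -> b \in G -> coprime #[a] #[b] -> commute a b.
Proof.
move=> nilG Ga Gb co_ab; apply/commute_sym/cent1P.
rewrite -cent_cycle -cycle_subG.
by apply: sub_nilpotent_cent2 nilG _ _ _; rewrite ?cycle_subG.
Qed.

Lemma nilpotent_mem_cycleM (gT : finGroupType) (G : {group gT}) (a b : gT) :
    nilpotent G -> a \in G -> b \in G -> coprime #[a] #[b] ->
  (<[a]> \subset <[a * b]>) && (<[b]> \subset <[a * b]>).
Proof.
move=> nilG Ga Gb co_ab.
have cab := nilpotent_commute nilG Ga Gb co_ab.
by rewrite cycleMsub //= cab cycleMsub // coprime_sym.
Qed.

(** With a single subgroup of order [p], ['Ohm_1(P)], being generated by the
    elements of order [p], has order [p]; this characterizes the cyclic and the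
    generalized quaternion p-groups. *)
Lemma pgroup_prime_subgroups_gt1 (gT : finGroupType) (P : {group gT}) (p : nat) :
    p.-group P -> P :!=: 1 -> ~ cyclic P -> ~ generalized_quaternion P ->
  1 < num_subgroups_of_order P p.
Proof.
move=> pP ntP ncycP nquaP; rewrite ltnNge; apply/negP => le1.
have [p_pr p_dvd _] := pgroup_pdiv pP ntP.
have [x Px ox] := Cauchy p_pr p_dvd.
suffices oOhm: #|'Ohm_1(P)| = p.
  have /(prime_Ohm1P pP ntP)/orP[//|/andP[_ /eqP/quaternion_classP]] := oOhm.
  exact: nquaP.
suffices ->: 'Ohm_1(P) = <[x]> by [].
apply/eqP; rewrite Ohm1Eprime eqEsubset gen_subG; apply/andP; split; last first.
  by rewrite cycle_subG mem_gen // inE Px ox.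
apply/subsetP=> y; rewrite inE => /andP[Py oy_pr].
have oy: #[y] = p.
  by have:= mem_p_elt pP Py; rewrite /p_elt pnatE // => /eqP.
suffices <-: <[y]>%G = <[x]>%G by apply: cycle_id.
by apply: (card_le1_eqP le1); rewrite inE cycle_subG -orderE ?Py ?Px ?oy ?ox /=.
Qed.

Lemma num_subgroups_of_orderS (gT : finGroupType) (H G : {group gT}) (q : nat) :
  H \subset G -> num_subgroups_of_order H q <= num_subgroups_of_order G q.
Proof.
move=> sHG; apply/subset_leq_card/subsetP => K; rewrite !inE => /andP[sKH ->].
by rewrite (subset_trans sKH).
Qed.

(** * Nilpotent groups with a cyclic complementary part *)

Section Nilpotent.

Variables (I : finType) (p : I -> nat) (gT : finGroupType) (G : {group gT}).

Let pi : nat_pred := [pred q in codom p].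
Let s i := num_subgroups_of_order G (p i).
Let subs i := [set H : {group gT} | (H \subset G) && (#|H| == p i)].
Let V := proper_epg_vertices G.

Hypothesis p_prime : forall i, prime (p i).
Hypothesis nilG : nilpotent G.
Hypothesis s_gt1 : forall i, 1 < s i.
Hypothesis cycC : cyclic 'O_pi^'(G).

Lemma epg_adjP x y :
  reflect (x != y /\ exists2 w, w \in G & (x \in <[w]>) && (y \in <[w]>))
          (epg_adj G x y).
Proof.
by apply: (iffP andP) => -[-> exw]; split=> //; apply/exists_inP.
Qed.

Lemma mem_pcoreC x : x \in G -> (x \in 'O_pi^'(G)) = pi^'.-elt x.
Proof. exact/mem_Hall_pcore/nilpotent_pcore_Hall. Qed.

Lemma notin_pcoreC x :
  x \in G -> reflect (exists i, p i %| #[x]) (x \notin 'O_pi^'(G)).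
Proof.
move=> Gx; rewrite mem_pcoreC //; apply: (iffP idP) => [|[i pi_x]].
  rewrite /p_elt /pnat order_gt0 /= => /allPn[q]; rewrite mem_primes.
  case/and3P=> _ _ qx; rewrite !inE negbK => /codomP[i def_q].
  by exists i; rewrite -def_q.
apply/negP=> /(pnat_dvd pi_x); rewrite pnatE ?p_prime //.
by rewrite !inE codom_f.
Qed.

(** Cyclicity of the core joins its elements to everything, and a second
    subgroup of order [p i] provides an element that [x] is not joined to when
    [p i] divides the order of [x]. *)
Lemma dominating_vertex_pcore x :
  x \in G -> dominating_vertex G (epg_adj G) x = (x \in 'O_pi^'(G)).
Proof.
move=> Gx; rewrite /dominating_vertex Gx /=; apply/forall_inP/idP; last first.
  move=> Cx y Gy; apply/implyP=> neq_yx; apply/epg_adjP; split.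
    by rewrite eq_sym.
  (* Both [x] and the pi'-part of [y] are powers of the generator [c]. *)
  have [c defC] := cyclicP cycC; have Cc: c \in 'O_pi^'(G).
    by rewrite defC cycle_id.
  have Gc := subsetP (pcore_sub _ _) _ Cc.
  have coyc: coprime #[y.`_pi] #[c].
    by apply: pnat_coprime (p_elt_constt _ _) _; rewrite -/(p_elt _ _) -mem_pcoreC.
  have Gyp z: y.`_z \in G by apply: groupX.
  have /andP[sy sc] := nilpotent_mem_cycleM nilG (Gyp pi) Gc coyc.
  exists (y.`_pi * c); first by rewrite groupM.
  rewrite (subsetP sc) -?defC //= -{1}(consttC pi y) groupM //.
    by rewrite -cycle_subG.
  by rewrite (subsetP sc) // -defC mem_pcoreC // p_elt_constt.
move=> dom_x; apply: contraT => /(notin_pcoreC Gx)[i pi_x].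
have [H sHx oH] := cycle_prime_subgroup (p_prime i) pi_x.
have subsH: H \in subs i.
  by rewrite inE oH eqxx andbT (subset_trans sHx) ?cycle_subG.
have [K] : exists K, K \in subs i :\ H.
  apply/card_gt0P; move: (s_gt1 i).
  by rewrite /s /num_subgroups_of_order -/(subs i) (cardsD1 H) subsH.
rewrite !inE => /and3P[neqKH sKG /eqP oK].
have [y defK] : exists y, K :=: <[y]>.
  by apply/cyclicP/prime_cyclic; rewrite oK.
have Gy: y \in G by rewrite -cycle_subG -defK.
have neq_yx: y != x.
  apply: contra neqKH => /eqP eq_yx; apply/eqP/esym.
  by apply: (@cycle_subgroup_inj _ x); rewrite ?oH // defK eq_yx.
have /implyP/(_ neq_yx)/epg_adjP[_ [w _ /andP[wx wy]]] := dom_x y Gy.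
case/eqP: neqKH; apply: (@cycle_subgroup_inj _ w); rewrite ?oH //.
  by rewrite defK cycle_subG.
by rewrite (subset_trans sHx) ?cycle_subG.
Qed.

Lemma proper_epg_verticesP x :
  reflect (x \in G /\ exists i, p i %| #[x]) (x \in V).
Proof.
rewrite inE; apply: (iffP andP) => -[Gx]; rewrite dominating_vertex_pcore //.
  by move/(notin_pcoreC Gx).
by move=> ex_i; split=> //; apply/(notin_pcoreC Gx).
Qed.

(** An element of order prime to [p i] is joined to every generator by their
    product; any other element has exactly one of the generators among its
    powers. *)
Lemma dominating_generators i :
  exists2 D, dominating_set V (epg_adj G) D & #|D| <= s i.
Proof.
pose gen (H : {group gT}) := odflt 1 [pick x | <[x]> == H].
have genE H: H \in subs i -> <[gen H]> = H.
  rewrite inE => /andP[_ /eqP oH]; rewrite /gen; case: pickP => [x /eqP //|no_x].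
  have /prime_cyclic/cyclicP[x defH]: prime #|H| by rewrite oH.
  by have:= no_x x; rewrite -defH eqxx.
have ogen H: H \in subs i -> #[gen H] = p i.
  by move=> sH; rewrite orderE genE //; move: sH; rewrite inE => /andP[_ /eqP].
have Ggen H: H \in subs i -> gen H \in G.
  by move=> sH; rewrite -cycle_subG genE //; move: sH; rewrite inE => /andP[].
exists (gen @: subs i); last exact: leq_imset_card.
apply/andP; split.
  apply/subsetP=> _ /imsetP[H sH ->]; apply/proper_epg_verticesP.
  by split; [apply: Ggen | exists i; rewrite ogen].
apply/forall_inP=> x /setDP[/proper_epg_verticesP[Gx _] notDx].
have neq_x H: H \in subs i -> x != gen H.
  by move=> sH; apply: contra notDx => /eqP->; apply: imset_f.
have [pi_x | p'x] := boolP (p i %| #[x]).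
  have [H sHx oH] := cycle_prime_subgroup (p_prime i) pi_x.
  have sH: H \in subs i.
    by rewrite inE oH eqxx andbT (subset_trans sHx) ?cycle_subG.
  apply/exists_inP; exists (gen H); first exact: imset_f.
  apply/epg_adjP; split; first exact: neq_x.
  by exists x => //; rewrite cycle_id -cycle_subG genE.
have [H sH] : exists H, H \in subs i by apply/card_gt0P/ltnW/s_gt1.
apply/exists_inP; exists (gen H); first exact: imset_f.
apply/epg_adjP; split; first exact: neq_x.
have co: coprime #[x] #[gen H] by rewrite ogen // coprime_sym prime_coprime.
exists (x * gen H); first by rewrite groupM ?Ggen.
by rewrite -!cycle_subG (nilpotent_mem_cycleM nilG) ?Ggen.
Qed.

Hypothesis p_inj : injective p.

(** The product of generators of the [H i]; the order of the partial product
    has to be tracked, so that the next generator is coprime to it. *)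
Lemma cyclic_join_prime_subgroups (H : I -> {group gT}) :
  (forall i, H i \in subs i) ->
  exists2 y, y \in G & forall i, H i \subset <[y]>.
Proof.
move=> subsH.
suffices [y [Gy _ sHy]]: exists y, [/\ y \in G,
    forall i, p i %| #[y] -> i \in enum I
  & forall i, i \in enum I -> H i \subset <[y]>].
  by exists y => // i; rewrite sHy ?mem_enum.
elim: (enum I) (enum_uniq I) => [_|i r IHr /= /andP[r'i /IHr[y [Gy ry sHy]]]].
  exists 1; split=> // i; rewrite order1 dvdn1 => /eqP p1.
  by have:= p_prime i; rewrite p1.
have /andP[sHG /eqP oH]: (H i \subset G) && (#|H i| == p i).
  by have:= subsH i; rewrite inE.
have [h defH] : exists h, H i :=: <[h]>.
  by apply/cyclicP/prime_cyclic; rewrite oH.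
have oh: #[h] = p i by rewrite orderE -defH.
have Gh: h \in G by rewrite -cycle_subG -defH.
have co: coprime #[h] #[y].
  by rewrite oh prime_coprime //; apply: contra r'i => /ry.
have /andP[sh sy] := nilpotent_mem_cycleM nilG Gh Gy co.
exists (h * y); split; first by rewrite groupM.
  move=> j; rewrite (orderM (nilpotent_commute nilG Gh Gy co)) //.
  rewrite Euclid_dvdM // oh dvdn_prime2 // in_cons.
  by case/orP=> [/eqP/p_inj-> | /ry->]; rewrite ?eqxx ?orbT.
move=> j; rewrite in_cons => /predU1P[->|/sHy sHj]; first by rewrite defH.
exact: subset_trans sy.
Qed.

(** An element whose powers include a well chosen subgroup of order [p i] for all
    [i] at once can only be joined to a vertex having one of these subgroups
    among its own powers; a set that is too small avoids some such choice. *)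
Lemma dominating_set_ge (i0 : I) D :
  dominating_set V (epg_adj G) D -> \big[minn/s i0]_i s i <= #|D|.
Proof.
case/andP=> sDV /forall_inP domD; rewrite leqNgt; apply/negP=> ltDs.
(* If every member of [subs i] were met, then sending [x] to the only subgroup
   of order [p i] of [<[x]>] would map [D] onto [subs i], which is too large. *)
have missed i: exists H, (H \in subs i)
                         && [forall x in D, ~~ (H \subset <[x]>)].
  apply/existsP; apply: contraT; rewrite negb_exists => /forallP hitD.
  pose sub x := odflt 1%G [pick H in subs i | H \subset <[x]>].
  suffices /subset_leq_card le_s: subs i \subset sub @: D.
    have:= leq_trans (bigminn_le s (s i0) i) (leq_trans le_s (leq_imset_card _ _)).
    by rewrite leqNgt ltDs.
  apply/subsetP=> H sH; have:= hitD H.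
  rewrite sH negb_forall_in => /exists_inP[x Dx]; rewrite negbK => sHx.
  apply/imsetP; exists x => //; rewrite /sub; case: pickP => [K|/(_ H)]; last first.
    by rewrite sH sHx.
  case/andP=> sK sKx; apply: cycle_subgroup_inj sHx sKx _.
  by move: sH sK; rewrite !inE => /andP[_ /eqP->] /andP[_ /eqP->].
pose H i := xchoose (missed i).
have subsH i: H i \in subs i by have /andP[] := xchooseP (missed i).
have notDH i x: x \in D -> ~~ (H i \subset <[x]>).
  by move=> Dx; have /andP[_ /forall_inP->] := xchooseP (missed i).
have oH i: #|H i| = p i by have:= subsH i; rewrite inE => /andP[_ /eqP].
have [y Gy sHy] := cyclic_join_prime_subgroups subsH.
have D'y: y \notin D by apply: contraL (sHy i0) => /notDH->.
have Vy: y \in V.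
  by apply/proper_epg_verticesP; split=> //; exists i0; rewrite -(oH i0) cardSg.
have /exists_inP[x Dx] : [exists x in D, epg_adj G y x].
  by apply: domD; rewrite inE D'y.
case/epg_adjP=> _ [w _ /andP[wy wx]].
have /proper_epg_verticesP[_ [i pi_x]] := subsetP sDV _ Dx.
have [K sKx oK] := cycle_prime_subgroup (p_prime i) pi_x.
have:= notDH i x Dx; rewrite (_ : H i = K) ?sKx //.
apply: (@cycle_subgroup_inj _ w); rewrite ?oK //.
  by rewrite (subset_trans (sHy i)) ?cycle_subG.
by rewrite (subset_trans sKx) ?cycle_subG.
Qed.

Lemma nilpotent_proper_epg_domination_number (i0 : I) :
  proper_epg_domination_number G = \big[minn/s i0]_i s i.
Proof.
have domV: dominating_set V (epg_adj G) V.
  by rewrite /dominating_set subxx setDv; apply/forall_inP=> x; rewrite inE.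
rewrite /proper_epg_domination_number /domination_number.
case: arg_minnP => // D domD minD.
apply/eqP; rewrite eqn_leq dominating_set_ge // andbT.
apply: bigminn_ge => i; have [S domS leSs] := dominating_generators i.
exact: leq_trans (minD S domS) leSs.
Qed.

End Nilpotent.

(** * Direct products of coprime orders *)

Lemma coprime_morph_eq1 (aT rT : finGroupType) (f : {morphism [set: aT] >-> rT})
    (z : aT) (K : {group rT}) :
  f z \in K -> coprime #[z] #|K| -> f z = 1.
Proof.
move=> Kfz; apply: contraTeq; rewrite -order_eq1 => nt.
apply/negP=> /(coprime_dvdl (morph_order f (in_setT z))).
by move/(coprime_dvdr (order_dvdG Kfz)); rewrite /coprime gcdnn (negPf nt).
Qed.

(** Coprimality makes the projection of a subgroup of order [q] on the second
    factor trivial, so that it comes from the first factor. *)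
Lemma num_subgroups_of_order_setX (aT rT : finGroupType) (G : {group aT})
    (K : {group rT}) (q : nat) :
  coprime q #|K| ->
  num_subgroups_of_order [group of setX G K] q = num_subgroups_of_order G q.
Proof.
move=> coqK; pose f (H : {group aT}) := (pairg1 rT @* H)%G.
have inj_f: injective f.
  move=> A B /(congr1 val) /= eqAB; apply/val_inj.
  by apply: (injm_morphim_inj (injm_pairg1 aT rT)) eqAB; apply: subsetT.
rewrite /num_subgroups_of_order -(card_imset _ inj_f).
apply: eq_card => H; apply/idP/imsetP => [|[A + ->]]; last first.
  rewrite !inE /= card_injm ?subsetT ?injm_pairg1 // morphim_pairg1 => /andP[sAG ->].
  by rewrite setXS ?sub1G.
rewrite inE => /andP[sHX /eqP oH].
have sH1: H \subset pairg1 rT @* [set: aT].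
  rewrite morphim_pairg1; apply/subsetP=> z Hz; rewrite inE in_setT inE /=.
  have:= subsetP sHX _ Hz; rewrite inE => /andP[_ Kz].
  apply/eqP; apply: (coprime_morph_eq1 (f := [morphism of snd])) Kz _.
  by apply: coprime_dvdl coqK; rewrite -oH order_dvdG.
have defH: H = f (pairg1 rT @*^-1 H)%G.
  by apply/val_inj; rewrite /= morphpreK.
exists (pairg1 rT @*^-1 H)%G => //; rewrite inE -oH {3}defH.
rewrite card_injm ?subsetT ?injm_pairg1 // eqxx andbT.
by apply/subsetP=> x /morphpreP[_ /(subsetP sHX)]; rewrite inE => /andP[].
Qed.

(** * Products of Sylow subgroups *)

Theorem theorem2p5 (m : nat) (m_ge2 : 2 <= m)
    (p : 'I_m -> nat) (p_prime : forall i, prime (p i)) (p_inj : injective p)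
    (gT : finGroupType) (G1 : {group gT}) (P : 'I_m -> {group gT})
    (G1_prod : \big[dprod/1]_(i < m) P i = G1)
    (P_pgroup : forall i, exists2 r, 1 <= r & #|P i| = (p i ^ r)%N)
    (P_not_cyclic : forall i, ~ cyclic (P i))
    (P_not_quaternion : forall i, ~ generalized_quaternion (P i)) :
  let s i := num_subgroups_of_order G1 (p i) in
  let min_s := \big[minn/s (Ordinal (ltnW m_ge2))]_(i < m) s i in
  proper_epg_domination_number G1 = min_s /\
  (forall n : nat, 0 < n -> coprime n #|G1| ->
     proper_epg_domination_number [group of setX G1 (Zp n)] = min_s).
Proof.
move=> s min_s.
have pP i: (p i).-group (P i).
  by have [r _ oP] := P_pgroup i; rewrite /pgroup oP pnatX pnat_id.
have ntP i: P i :!=: 1.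
  by apply/eqP=> P1; apply: (P_not_cyclic i); rewrite P1 cyclic1.
have sPG i: P i \subset G1.
  by rewrite -(bigdprodWY G1_prod) sub_gen // (bigcup_sup i).
have nilG1: nilpotent G1.
  by apply: bigdprod_nil G1_prod _ => i _; apply: pgroup_nil (pP i).
have s_gt1 i: 1 < s i.
  apply: leq_trans (num_subgroups_of_orderS _ (sPG i)).
  exact: pgroup_prime_subgroups_gt1.
pose pi : nat_pred := [pred q in codom p].
have piG1: pi.-group G1.
  rewrite /pgroup -(bigdprod_card G1_prod).
  elim/big_ind: _ => // [a b pi_a pi_b|i _]; first by rewrite pnatM pi_a.
  by apply: sub_in_pnat (pP i) => q _ /eqP->; rewrite inE codom_f.
split.
  apply: nilpotent_proper_epg_domination_number => //=.
  rewrite (_ : 'O_pi^'(G1) = 1) ?cyclic1 //; apply: card1_trivg.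
  apply: (@pnat_1 pi); last exact: pcore_pgroup.
  by apply: pgroupS piG1; apply: pcore_sub.
move=> n n_gt0 co_n.
have cycZ: cyclic (Zp n).
  by rewrite /Zp; case: ifP => _; rewrite ?cyclic1 // Zp_cycle cycle_cyclic.
have eq_s i: num_subgroups_of_order [group of setX G1 (Zp n)] (p i) = s i.
  apply: num_subgroups_of_order_setX; rewrite card_Zp //.
  rewrite coprime_sym (coprime_dvdr _ co_n) //.
  apply: dvdn_trans (cardSg (sPG i)).
  by have [_ ? _] := pgroup_pdiv (pP i) (ntP i).
rewrite /min_s -(eq_bigr _ (fun i _ => eq_s i)) -eq_s.
apply: nilpotent_proper_epg_domination_number => //=.
- rewrite (dprod_nil (setX_dprod G1 [group of Zp n])) /=.
  rewrite -(isog_nil (isog_setX1 _ _)) -(isog_nil (isog_set1X _ _)) nilG1.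
  by rewrite abelian_nil ?cyclic_abelian.
- by move=> i; rewrite eq_s.
set C := 'O__(_).
apply: (@cyclicS _ (setX 1 (Zp n))).
  apply/subsetP=> z Cz; have:= subsetP (pcore_sub _ _) _ Cz; rewrite inE => /andP[Gz Zz].
  rewrite inE Zz andbT inE; apply/eqP.
  apply: (coprime_morph_eq1 (f := [morphism of fst])) Gz _.
  rewrite coprime_sym (pnat_coprime piG1) //.
  by apply: mem_p_elt Cz; apply: pcore_pgroup.
by rewrite -(isog_cyclic (isog_set1X _ [group of Zp n])).
Qed.
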